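(* Let $N$ be a Nijenhuis operator on a $3$-Lie algebra $(\mathfrak{g},[\cdot,\cdot,\cdot])$, and write $\pi(x,y,z)=[x,y,z]$. Then $(\mathfrak{g},[\cdot,\cdot,\cdot],[\cdot,\cdot,\cdot]_N)$ is a compatible $3$-Lie algebra if and only if $[\pi,N]_{\mathrm{3Lie}}$ is a $3$-Lie algebra structure on $\mathfrak{g}$.
   Context: All vector spaces are finite-dimensional over an algebraically closed field $\mathbb{K}$ of characteristic $0$. A 3-Lie algebra is a vector space $\mathfrak{g}$ with a skew-symmetric trilinear map $[\cdot,\cdot,\cdot]:\wedge^3\mathfrak{g}\to\mathfrak{g}$ such that $[x_1,x_2,[x_3,x_4,x_5]]=[[x_1,x_2,x_3],x_4,x_5]+[x_3,[x_1,x_2,x_4],x_5]+[x_3,x_4,[x_1,x_2,x_5]]$ for all $x_i\in\mathfrak{g}$. A compatible 3-Lie algebra is a triple $(\mathfrak{g},[\cdot,\cdot,\cdot],\{\cdot,\cdot,\cdot\})$ where $[\cdot,\cdot,\cdot]$ and $\{\cdot,\cdot,\cdot\}$ are 3-Lie algebra structures on $\mathfrak{g}$ such that for all $x_1,\dots,x_5\in\mathfrak{g}$: $[x_1,x_2,\{x_3,x_4,x_5\}]+\{x_1,x_2,[x_3,x_4,x_5]\}=[\{x_1,x_2,x_3\},x_4,x_5]+\{[x_1,x_2,x_3],x_4,x_5\}+[x_3,\{x_1,x_2,x_4\},x_5]+\{x_3,[x_1,x_2,x_4],x_5\}+[x_3,x_4,\{x_1,x_2,x_5\}]+\{x_3,x_4,[x_1,x_2,x_5]\}$.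 For a linear map $N:\mathfrak{g}\to\mathfrak{g}$, set $[x,y,z]_N=[Nx,Ny,z]+[x,Ny,Nz]+[Nx,y,Nz]-N[Nx,y,z]-N[x,Ny,z]-N[x,y,Nz]+N^2[x,y,z]$. $N$ is a Nijenhuis operator on the 3-Lie algebra $(\mathfrak{g},[\cdot,\cdot,\cdot])$ if $[Nx,Ny,Nz]=N([x,y,z]_N)$ for all $x,y,z\in\mathfrak{g}$. It is known that then $(\mathfrak{g},[\cdot,\cdot,\cdot]_N)$ is a 3-Lie algebra, called the deformed 3-Lie algebra. For $P\in\mathrm{Hom}(\wedge^3\mathfrak{g},\mathfrak{g})$ and a linear map $N:\mathfrak{g}\to\mathfrak{g}$, $[P,N]_{\mathrm{3Lie}}\in\mathrm{Hom}(\wedge^3\mathfrak{g},\mathfrak{g})$ is given by $[P,N]_{\mathrm{3Lie}}(x,y,z)=P(Nx,y,z)+P(x,Ny,z)+P(x,y,Nz)-N(P(x,y,z))$. *)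

(* Defs.v *)
From HB Require Import structures.
From mathcomp Require Import all_boot all_order all_algebra.

Set Implicit Arguments.
Unset Strict Implicit.
Unset Printing Implicit Defensive.

Import GRing.Theory.
Local Open Scope ring_scope.

Section ThreeLie.
Variables (K : fieldType) (V : vectType K).
Implicit Types (p q : V -> V -> V -> V) (N : 'End(V)).

Definition trilinear p : Prop :=
  [/\ forall y z, linear (fun x => p x y z),
      forall x z, linear (fun y => p x y z)
    & forall x y, linear (fun z => p x y z)].

(* The two adjacent transpositions generate the symmetric group on the three
   arguments. *)
Definition skew_symmetric p : Prop :=
  (forall x y z, p y x z = - p x y z) /\ (forall x y z, p x z y = - p x y z).

Definition fundamental_identity p : Prop :=
  forall x1 x2 x3 x4 x5,
    p x1 x2 (p x3 x4 x5) =
      p (p x1 x2 x3) x4 x5 + p x3 (p x1 x2 x4) x5 + p x3 x4 (p x1 x2 x5).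

Definition is_3Lie p : Prop :=
  [/\ trilinear p, skew_symmetric p & fundamental_identity p].

Definition compatibility_identity p q : Prop :=
  forall x1 x2 x3 x4 x5,
    p x1 x2 (q x3 x4 x5) + q x1 x2 (p x3 x4 x5) =
      p (q x1 x2 x3) x4 x5 + q (p x1 x2 x3) x4 x5
      + p x3 (q x1 x2 x4) x5 + q x3 (p x1 x2 x4) x5
      + p x3 x4 (q x1 x2 x5) + q x3 x4 (p x1 x2 x5).

Definition is_compatible_3Lie p q : Prop :=
  [/\ is_3Lie p, is_3Lie q & compatibility_identity p q].

Definition deformed_bracket p N (x y z : V) : V :=
  p (N x) (N y) z + p x (N y) (N z) + p (N x) y (N z)
  - N (p (N x) y z) - N (p x (N y) z) - N (p x y (N z)) + N (N (p x y z)).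

Definition is_Nijenhuis p N : Prop :=
  forall x y z, p (N x) (N y) (N z) = N (deformed_bracket p N x y z).

Definition bracket_3Lie p N (x y z : V) : V :=
  p (N x) y z + p x (N y) z + p x y (N z) - N (p x y z).

End ThreeLie.

(* Main.v *)
Require Import Defs.
From mathcomp Require Import all_boot all_order all_algebra.
From mathcomp Require Import ring.
Import GRing.Theory.
Local Open Scope ring_scope.

(** Write w1 = [p, N] for [bracket_3Lie p N] and w2 for the deformed bracket.
    For a scalar t put f_t = 1 + t N and w_t = p + t w1 + t^2 w2.  The
    brackets w1 and w2 and the Nijenhuis condition are precisely what comes
    out of comparing coefficients of t, t^2 and t^3 in
      f_t (w_t (x, y, z)) = p (f_t x, f_t y, f_t z),
    so f_t intertwines w_t with p ([pencil_intertwined]).  Hence f_t sends the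
    defect of the fundamental identity for w_t to the one for p, which is zero
    ([defect_intertwined]).  That defect is a polynomial a_0 + ... + a_4 t^4
    with vector coefficients, and (1 + t N)(a_0 + ... + a_4 t^4) = 0 for all t
    forces a_0 = ... = a_4 = 0 one after the other, as K is infinite
    ([coefficients_eq0]).

    The coefficient a_4 is the defect of w2, so w2 is a 3-Lie bracket.  The
    coefficient a_2 is the sum of the defect of w1 and of the compatibility
    defect of p and w2, so one of these vanishes exactly when the other does,
    which is the equivalence. *)

(** * Vector identities and vector-valued polynomials *)

Section Vectors.
Context {K : fieldType} {V : vectType K}.

(** Passing to coordinates turns an identity of vectors into one in the
    commutative ring K, where ring normalisation applies. *)
Lemma eq_coord (u v : V) :
  (forall i, coord (vbasis fullv) i u = coord (vbasis fullv) i v) -> u = v.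
Proof.
move=> uv; rewrite (coord_vbasis (memvf u)) (coord_vbasis (memvf v)).
by apply: eq_bigr => i _; rewrite uv.
Qed.

Section LinearRules.
Variables (N : 'End(V)) (n : nat) (b : n.-tuple V) (i : 'I_n).
Implicit Types (a : K) (u v : V).

Lemma endD u v : N (u + v) = N u + N v. Proof. exact: linearD. Qed.
Lemma endN u : N (- u) = - N u. Proof. exact: linearN. Qed.
Lemma endZ a u : N (a *: u) = a *: N u. Proof. exact: linearZ. Qed.
Lemma end0 : N 0 = 0. Proof. exact: linear0. Qed.

Lemma coordD u v : coord b i (u + v) = coord b i u + coord b i v.
Proof. exact: linearD. Qed.
Lemma coordN u : coord b i (- u) = - coord b i u. Proof. exact: linearN. Qed.
Lemma coordZ a u : coord b i (a *: u) = a * coord b i u.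
Proof. exact: linearZ. Qed.
Lemma coord0v : coord b i 0 = 0. Proof. exact: linear0. Qed.

End LinearRules.

Definition endE := (endD, endN, endZ, end0).
Definition coordE := (coordD, coordN, coordZ, coord0v).

End Vectors.

(* Abstracting the coordinates leaves variables of K as the only atoms. *)
Ltac vring :=
  apply: eq_coord => ?; rewrite ?endE ?coordE;
  repeat match goal with
    |- context [coord ?b ?i ?x] => move: (coord b i x) => ?
  end;
  ring.

Section PolynomialFunctions.
Context {K : closedFieldType} {V : vectType K}.

(** If q vanishes everywhere then q + 1 has no root, so over an algebraically
    closed field q is a constant, equal to its value 0. *)
Lemma poly_fun_eq0 (q : {poly K}) : (forall t, q.[t] = 0) -> q = 0.
Proof.
move=> q0; have : ~~ (size (q + 1) != 1%N).
  apply/closed_rootP => -[t]; rewrite rootE !hornerE q0 add0r.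
  by rewrite oner_eq0.
rewrite negbK => /eqP/eq_leq/size1_polyC qc.
have {}qc : q = ((q + 1)`_0 - 1)%:P by rewrite polyCB -qc addrK.
by move: (q0 0); rewrite qc hornerC => ->.
Qed.

Lemma vector_poly_fun_eq0 n (a : nat -> V) :
  (forall t : K, \sum_(k < n) t ^+ k *: a k = 0) ->
  forall k, (k < n)%N -> a k = 0.
Proof.
move=> a0 k kn; apply: eq_coord => i; rewrite linear0.
pose q := \poly_(j < n) coord (vbasis fullv) i (a j).
have q0 : q = 0.
  apply: poly_fun_eq0 => t; rewrite horner_poly.
  have /(congr1 (coord (vbasis fullv) i)) := a0 t.
  rewrite linear0 linear_sum => e; rewrite -[RHS]e.
  by apply: eq_bigr => j _; rewrite linearZ mulrC.
by have := coef_poly n (fun j => coord (vbasis fullv) i (a j)) k;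
   rewrite -/q q0 coef0 kn.
Qed.

(** The coefficients of (1 + t N)(a_0 + ... + a_4 t^4) are a_k + N a_(k-1),
    so their vanishing kills the a_k by induction on k. *)
Lemma coefficients_eq0 (N : 'End(V)) (a0 a1 a2 a3 a4 : V) :
  (forall t : K, let s := a0 + t *: a1 + t ^+ 2 *: a2 + t ^+ 3 *: a3
                          + t ^+ 4 *: a4 in
     s + t *: N s = 0) ->
  [/\ a0 = 0, a1 = 0, a2 = 0, a3 = 0 & a4 = 0].
Proof.
move=> H.
pose b := [:: a0; a1 + N a0; a2 + N a1; a3 + N a2; a4 + N a3; N a4].
have b0 : forall k, (k < 6)%N -> nth 0 b k = 0.
  apply: vector_poly_fun_eq0 => t; rewrite -[RHS](H t).
  by rewrite !big_ord_recl big_ord0 /bump /=; vring.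
have e0 : a0 = 0 := b0 0 isT.
have e1 : a1 = 0 by have := b0 1 isT; rewrite /= e0 linear0 addr0.
have e2 : a2 = 0 by have := b0 2 isT; rewrite /= e1 linear0 addr0.
have e3 : a3 = 0 by have := b0 3 isT; rewrite /= e2 linear0 addr0.
have e4 : a4 = 0 by have := b0 4 isT; rewrite /= e3 linear0 addr0.
by [].
Qed.

End PolynomialFunctions.

(** * Trilinear brackets and the defect of the fundamental identity *)

Section Trilinear.
Context {K : fieldType} {V : vectType K} {p : V -> V -> V -> V}.
Hypothesis tp : trilinear p.

Lemma trilinearD1 x x' y z : p (x + x') y z = p x y z + p x' y z.
Proof. by case: tp => h _ _; have := h y z 1 x x'; rewrite !scale1r. Qed.
Lemma trilinearD2 x y y' z : p x (y + y') z = p x y z + p x y' z.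
Proof. by case: tp => _ h _; have := h x z 1 y y'; rewrite !scale1r. Qed.
Lemma trilinearD3 x y z z' : p x y (z + z') = p x y z + p x y z'.
Proof. by case: tp => _ _ h; have := h x y 1 z z'; rewrite !scale1r. Qed.

Lemma trilinear01 y z : p 0 y z = 0.
Proof. by apply: (addrI (p 0 y z)); rewrite -trilinearD1 !addr0. Qed.
Lemma trilinear02 x z : p x 0 z = 0.
Proof. by apply: (addrI (p x 0 z)); rewrite -trilinearD2 !addr0. Qed.
Lemma trilinear03 x y : p x y 0 = 0.
Proof. by apply: (addrI (p x y 0)); rewrite -trilinearD3 !addr0. Qed.

Lemma trilinearZ1 a x y z : p (a *: x) y z = a *: p x y z.
Proof.
by case: tp => h _ _; have := h y z a x 0; rewrite trilinear01 !addr0.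
Qed.
Lemma trilinearZ2 a x y z : p x (a *: y) z = a *: p x y z.
Proof.
by case: tp => _ h _; have := h x z a y 0; rewrite trilinear02 !addr0.
Qed.
Lemma trilinearZ3 a x y z : p x y (a *: z) = a *: p x y z.
Proof.
by case: tp => _ _ h; have := h x y a z 0; rewrite trilinear03 !addr0.
Qed.

Definition trilinearDZ := (trilinearD1, trilinearD2, trilinearD3,
  trilinearZ1, trilinearZ2, trilinearZ3).

End Trilinear.

Section Defect.
Context {K : fieldType} {V : vectType K}.
Implicit Types (p q : V -> V -> V -> V) (f N : 'End(V)).

(** Polarising the fundamental identity in its outer bracket p and its inner
    bracket q makes the defect of a pencil of brackets a polynomial. *)
Definition defect p q (x1 x2 x3 x4 x5 : V) : V :=
  p x1 x2 (q x3 x4 x5)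
  - (p (q x1 x2 x3) x4 x5 + p x3 (q x1 x2 x4) x5 + p x3 x4 (q x1 x2 x5)).

Lemma fundamental_identityP p :
  fundamental_identity p <->
  forall x1 x2 x3 x4 x5, defect p p x1 x2 x3 x4 x5 = 0.
Proof.
split=> h x1 x2 x3 x4 x5; first by rewrite /defect h subrr.
exact: subr0_eq (h x1 x2 x3 x4 x5).
Qed.

Lemma compatibility_identityP p q :
  compatibility_identity p q <->
  forall x1 x2 x3 x4 x5,
    defect p q x1 x2 x3 x4 x5 + defect q p x1 x2 x3 x4 x5 = 0.
Proof.
split=> h x1 x2 x3 x4 x5.
  have /eqP := h x1 x2 x3 x4 x5; rewrite -subr_eq0 => /eqP <-.
  by rewrite /defect; vring.
by apply: subr0_eq; rewrite -[RHS](h x1 x2 x3 x4 x5) /defect; vring.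
Qed.

Lemma defect_intertwined p q f :
  (forall x y z, f (q x y z) = p (f x) (f y) (f z)) ->
  forall x1 x2 x3 x4 x5,
    f (defect q q x1 x2 x3 x4 x5)
    = defect p p (f x1) (f x2) (f x3) (f x4) (f x5).
Proof. by move=> h *; rewrite /defect linearB !linearD /= !h. Qed.

Definition pencil p0 p1 p2 (t : K) (x y z : V) : V :=
  p0 x y z + t *: p1 x y z + t ^+ 2 *: p2 x y z.

Lemma defect_pencil p0 p1 p2 t x1 x2 x3 x4 x5 :
  trilinear p0 -> trilinear p1 -> trilinear p2 ->
  let d p q := defect p q x1 x2 x3 x4 x5 in
  let w := pencil p0 p1 p2 t in
  d w w = d p0 p0 + t *: (d p0 p1 + d p1 p0)
          + t ^+ 2 *: (d p0 p2 + d p2 p0 + d p1 p1)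
          + t ^+ 3 *: (d p1 p2 + d p2 p1) + t ^+ 4 *: d p2 p2.
Proof.
move=> t0 t1 t2 /=; rewrite /defect /pencil.
rewrite !(trilinearDZ t0) !(trilinearDZ t1) !(trilinearDZ t2).
by vring.
Qed.

(** * The two brackets attached to an operator *)

Section Brackets.
Context {p : V -> V -> V -> V} (N : 'End(V)).

Lemma bracket_3Lie_trilinear : trilinear p -> trilinear (bracket_3Lie p N).
Proof.
move=> tp; split=> ? ? a u v /=;
  by rewrite /bracket_3Lie !endE !(trilinearDZ tp); vring.
Qed.

Lemma deformed_bracket_trilinear :
  trilinear p -> trilinear (deformed_bracket p N).
Proof.
move=> tp; split=> ? ? a u v /=;
  by rewrite /deformed_bracket !endE !(trilinearDZ tp); vring.
Qed.

Lemma bracket_3Lie_skew :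
  skew_symmetric p -> skew_symmetric (bracket_3Lie p N).
Proof.
move=> [s1 s2]; split=> x y z; rewrite /bracket_3Lie.
  by rewrite (s1 x (N y)) (s1 (N x) y) !(s1 x y); vring.
by rewrite (s2 _ y (N z)) (s2 _ (N y) z) !(s2 _ y z); vring.
Qed.

Lemma deformed_bracket_skew :
  skew_symmetric p -> skew_symmetric (deformed_bracket p N).
Proof.
move=> [s1 s2]; split=> x y z; rewrite /deformed_bracket.
  by rewrite (s1 (N x) (N y)) !(s1 x (N y)) !(s1 (N x) y) !(s1 x y); vring.
by rewrite (s2 _ (N y) (N z)) !(s2 _ y (N z)) !(s2 _ (N y) z) !(s2 _ y z);
  vring.
Qed.

(** Comparing powers of t, the coefficient of t is the definition of
    [bracket_3Lie], that of t^2 the definition of [deformed_bracket], and that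
    of t^3 the Nijenhuis condition. *)
Lemma pencil_intertwined t : trilinear p -> is_Nijenhuis p N ->
  let f : 'End(V) := (\1 + t *: N)%VF in
  forall x y z,
    f (pencil p (bracket_3Lie p N) (deformed_bracket p N) t x y z)
    = p (f x) (f y) (f z).
Proof.
move=> tp nij /= x y z; rewrite !add_lfunE !scale_lfunE !id_lfunE.
rewrite !(trilinearDZ tp) nij /pencil.
by rewrite /deformed_bracket /bracket_3Lie; vring.
Qed.

End Brackets.
End Defect.

(** * Vanishing of the coefficients of the pencil *)

Section Nijenhuis.
Context {K : closedFieldType} {V : vectType K}.
Context {p : V -> V -> V -> V} {N : 'End(V)}.
Hypotheses (Lp : is_3Lie p) (nij : is_Nijenhuis p N).
Let w1 := bracket_3Lie p N.
Let w2 := deformed_bracket p N.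

Lemma Nijenhuis_defects x1 x2 x3 x4 x5 :
  let d q r := defect q r x1 x2 x3 x4 x5 in
  d p w2 + d w2 p + d w1 w1 = 0 /\ d w2 w2 = 0.
Proof.
move=> d; have [tp _ /fundamental_identityP fp] := Lp.
have [|_ _ e2 _ e4] := @coefficients_eq0 K V N (d p p) (d p w1 + d w1 p)
  (d p w2 + d w2 p + d w1 w1) (d w1 w2 + d w2 w1) (d w2 w2).
  move=> t; rewrite /d -defect_pencil //.
  - have := @defect_intertwined _ _ _ _ _ (@pencil_intertwined _ _ _ N t tp nij)
              x1 x2 x3 x4 x5.
    by rewrite fp !add_lfunE !scale_lfunE !id_lfunE.
  - exact: bracket_3Lie_trilinear.
  - exact: deformed_bracket_trilinear.
by [].
Qed.

Lemma deformed_bracket_is_3Lie : is_3Lie w2.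
Proof.
have [tp sp _] := Lp; split.
- exact: deformed_bracket_trilinear.
- exact: deformed_bracket_skew.
- by apply/fundamental_identityP => *; apply: (Nijenhuis_defects _ _ _ _ _).2.
Qed.

Lemma compatibility_iff_fundamental :
  compatibility_identity p w2 <-> fundamental_identity w1.
Proof.
split=> [/compatibility_identityP c|/fundamental_identityP c].
  apply/fundamental_identityP => x1 x2 x3 x4 x5.
  by have [+ _] := Nijenhuis_defects x1 x2 x3 x4 x5; rewrite /= c add0r.
apply/compatibility_identityP => x1 x2 x3 x4 x5.
by have [+ _] := Nijenhuis_defects x1 x2 x3 x4 x5; rewrite /= c addr0.
Qed.

End Nijenhuis.

Theorem proposition3p9 (K : closedFieldType) (charK0 : [pchar K] =i pred0)
    (V : vectType K) (p : V -> V -> V -> V) (N : 'End(V)) :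
  is_3Lie p -> is_Nijenhuis p N ->
  (is_compatible_3Lie p (deformed_bracket p N) <-> is_3Lie (bracket_3Lie p N)).
Proof.
move=> Lp nij; have [tp sp _] := Lp.
split=> [[_ _ c]|[_ _ c]]; split=> //.
- exact: bracket_3Lie_trilinear.
- exact: bracket_3Lie_skew.
- exact/(compatibility_iff_fundamental Lp nij).
- exact: deformed_bracket_is_3Lie.
- exact/(compatibility_iff_fundamental Lp nij).
Qed.
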